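(* Consider the flux-differencing semi-discretization $$ \begin{aligned} \omega_i\omega_j J_{ij}\frac{\mathrm d}{\mathrm dt}\boldsymbol u_{ij} &= \omega_j\Big(-\sum_{m=0}^N S_{im}(J\boldsymbol f^1)^{\#}_{ij,mj}+\delta_{i0}(J\boldsymbol f^1)^{*}_{0j,0j^+}-\delta_{iN}(J\boldsymbol f^1)^{*}_{Nj,Nj^+}\Big)\\ &\quad+\omega_i\Big(-\sum_{m=0}^N S_{jm}(J\boldsymbol f^2)^{\#}_{ij,im}+\delta_{j0}(J\boldsymbol f^2)^{*}_{i0,i0^+}-\delta_{jN}(J\boldsymbol f^2)^{*}_{iN,iN^+}\Big)+\omega_i\omega_jJ_{ij}\boldsymbol s_{ij},\quad 0\le i,j\le N, \end{aligned} $$ with $\boldsymbol u=(h,hv^1,hv^2)^{\mathrm T}$. Take both the volume flux $(J\boldsymbol f^j)^{\#}_{L,R}$ and the interface flux $(J\boldsymbol f^j)^{*}_{L,R}$, $j\in\{1,2\}$, to be the vector $(\phi^j_0,\phi^j_1,\phi^j_2)^{\mathrm T}$ with $\phi^j_0=\frac12[(Jhv^j)_L+(Jhv^j)_R]$ and, for $i\in\{1,2\}$, $$\phi^j_i=\tfrac14\big[(Jhv^jv^i)_L+(Jhv^jv^i)_R+(Jhv^j)_R(v^i)_L+(G^{ik}Jhv^j)_L(v_k)_R\big]+\tfrac g2(G^{ij}Jh)_Lh_R+\tfrac g2(G^{ij}Jh)_L(b_R-b_L),$$ and take the source term to be $\boldsymbol s=(0,s^1,s^2)^{\mathrm T}$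 with $$s^i=-\tfrac12\big(\Gamma^i_{jk}hv^jv^k-G^{ik}\Gamma^l_{jk}hv^jv_l\big)-fJG^{ij}\varepsilon_{jk}hv^k.$$ Then the scheme is a consistent discretization of the covariant shallow water system $$\partial_th+\tfrac1J\partial_j(Jhv^j)=0,\qquad \partial_t(hv^i)+\tfrac1J\partial_j(J\tau^{ij})=-fJG^{ij}\varepsilon_{jk}hv^k-ghG^{ij}\partial_jb-\Gamma^i_{jk}\tau^{jk},\qquad \tau^{ij}=hv^iv^j+\tfrac g2h^2G^{ij}.$$
   Context: Summation over Latin indices in $\{1,2\}$ repeated in upper and lower positions is implied for tensor components (not for node indices). $S\subset\mathbb R^3$ is a surface tessellated by a conforming mesh of quadrilateral elements, each the image of $[-1,1]^2$ (coordinates $\xi^1,\xi^2$, partial derivatives $\partial_1,\partial_2$) under a smooth, bijective, time-invariant mapping $\vec X$. With $\vec a_i=\partial_i\vec X$: $G_{ij}=\vec a_i\cdot\vec a_j$, $\boldsymbol G=(G_{ij})$ is symmetric positive definite with inverse $(G^{ij})$, $J=\sqrt{\det\boldsymbol G}$, $\Gamma^i_{jk}=\frac12G^{il}(\partial_jG_{kl}+\partial_kG_{jl}-\partial_lG_{jk})$. Velocity $\vec v=v^i\vec a_i$, $v_i=G_{ij}v^j$. $h>0$ is fluid depth, $g>0$ constant gravity, $b$ bottom topography, $f$ Coriolis parameter, $\varepsilon_{12}=1$, $\varepsilon_{21}=-1$, $\varepsilon_{11}=\varepsilon_{22}=0$. The contravariant flux is $\boldsymbol f^j=(hv^j,\tau^{1j},\tau^{2j})^{\mathrm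 T}$. Let $\{\xi_i\}_{i=0}^N\subset[-1,1]$ be the Legendre--Gauss--Lobatto nodes (including endpoints) with positive weights $\omega_i$ and Lagrange polynomials $\ell_i$. $(\cdot)_{ij}$ denotes a quantity at $(\xi_i,\xi_j)$. Matrices (zero-based): $D_{ij}=\ell_j'(\xi_i)$, $M_{ij}=\omega_i\delta_{ij}$, $\boldsymbol Q=\boldsymbol M\boldsymbol D$, $\boldsymbol B=\mathrm{diag}(-1,0,\dots,0,1)$, $\boldsymbol S=2\boldsymbol Q-\boldsymbol B$. They satisfy $\boldsymbol Q+\boldsymbol Q^{\mathrm T}=\boldsymbol B$ and $\sum_mD_{im}=0$. E.g. $(J\boldsymbol f^1)^{\#}_{ij,mj}$ has left state at $(\xi_i,\xi_j)$ and right state at $(\xi_m,\xi_j)$. A superscript ''$+$'' on a subscript denotes the external state at the coincident node of the adjacent element, with momentum components transformed to the local basis of the interior node; in interface fluxes all geometric quantities for both arguments are evaluated on the interior side (first subscript). For two-point fluxes with $(J\boldsymbol f^k)^{\#}_{ij,ij}=(J\boldsymbol f^k)^{*}_{ij,ij}=(J\boldsymbol f^k)_{ij}$, the scheme has the equivalent strong form $$ \begin{aligned} \tfrac{\mathrm d}{\mathrm dt}\boldsymbol u_{ij}=&-\tfrac1{J_{ij}}\sum_{m}2D_{im}(J\boldsymbol f^1)^{\#}_{ij,mj}-\tfrac1{J_{ij}}\sum_{m}2D_{jm}(J\boldsymbol f^2)^{\#}_{ij,im}+\boldsymbol s_{ij}\\ &+\tfrac{\delta_{i0}}{J_{ij}\omega_i\omega_j}\,\omega_j\big[(J\boldsymbol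 f^1)^{*}_{0j,0j^+}-(J\boldsymbol f^1)_{0j}\big]-\tfrac{\delta_{iN}}{J_{ij}\omega_i\omega_j}\,\omega_j\big[(J\boldsymbol f^1)^{*}_{Nj,Nj^+}-(J\boldsymbol f^1)_{Nj}\big]\\ &+\tfrac{\delta_{j0}}{J_{ij}\omega_i\omega_j}\,\omega_i\big[(J\boldsymbol f^2)^{*}_{i0,i0^+}-(J\boldsymbol f^2)_{i0}\big]-\tfrac{\delta_{jN}}{J_{ij}\omega_i\omega_j}\,\omega_i\big[(J\boldsymbol f^2)^{*}_{iN,iN^+}-(J\boldsymbol f^2)_{iN}\big]. \end{aligned} $$ ''Consistent discretization'' is meant in the following sense: (i) the bracketed interface differences in the strong form vanish when $h,\vec v,b$ are globally continuous across element interfaces; and (ii) the remaining right-hand side at node $(\xi_i,\xi_j)$ is obtained from a spatial differential expression that equals, for smooth solutions, the one giving $\partial_t\boldsymbol u$ in the covariant shallow water system $$\partial_th+\tfrac1J\partial_j(Jhv^j)=0,\qquad \partial_t(hv^i)+\tfrac1J\partial_j(J\tau^{ij})=-fJG^{ij}\varepsilon_{jk}hv^k-ghG^{ij}\partial_jb-\Gamma^i_{jk}\tau^{jk},\qquad \tau^{ij}=hv^iv^j+\tfrac g2h^2G^{ij},$$ by replacing each partial derivative $\partial_1\varphi$ and $\partial_2\varphi$ at that node by the nodal (SBP) approximations $\sum_mD_{im}\varphi_{mj}$ and $\sum_mD_{jm}\varphi_{im}$, respectively. *)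

(* Defs.v *)
From HB Require Import structures.
From mathcomp Require Import all_boot all_order all_algebra.
From mathcomp Require Import all_classical all_reals all_analysis.

Set Implicit Arguments.
Unset Strict Implicit.
Unset Printing Implicit Defensive.

Import Order.TTheory GRing.Theory Num.Theory.
Import numFieldNormedType.Exports.

Local Open Scope classical_set_scope.
Local Open Scope ring_scope.

                                       
                                                                         
                                 

Section Geometry.
Context {R : realType}.

Definition pd {V : normedModType R} (a : 'I_2) (phi : 'rV[R]_2 -> V)
    (x : 'rV[R]_2) : V :=
  'D_(delta_mx 0 a) phi x.

Definition pt (x y : R) : 'rV[R]_2 := \row_a (if a == ord0 then x else y).

Definition square : set 'rV[R]_2 := [set x | forall a, -1 <= x 0 a <= 1].

                                                                     
                                                                               
Definition smooth {V : normedModType R} (phi : 'rV[R]_2 -> V) : Prop :=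
  exists U : set 'rV[R]_2, [/\ open U, square `<=` U &
    forall (s : seq 'I_2) x, U x -> differentiable (foldr pd phi s) x].

Definition dotv (u w : 'rV[R]_3) : R := (u *m w^T) 0 0.

Definition metric (X : 'rV[R]_2 -> 'rV[R]_3) (x : 'rV[R]_2) : 'M[R]_2 :=
  \matrix_(i, j) dotv (pd i X x) (pd j X x).

Definition christoffel (X : 'rV[R]_2 -> 'rV[R]_3) (x : 'rV[R]_2)
    (i j k : 'I_2) : R :=
  2^-1 * \sum_(l < 2) invmx (metric X x) i l *
    (pd j (fun y => metric X y k l) x + pd k (fun y => metric X y j l) x
     - pd l (fun y => metric X y j k) x).

Definition element_map (X : 'rV[R]_2 -> 'rV[R]_3) : Prop :=
  [/\ smooth X, {in square &, injective X} &
      forall x, square x -> forall w : 'rV[R]_2, w != 0 ->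
        0 < (w *m metric X x *m w^T) 0 0].

Definition eps (j k : 'I_2) : R := (j < k)%N%:R - (k < j)%N%:R.

                                                                              
                                                                            
Definition side : Type := ('I_2 * bool)%type.

Definition side_pt (s : side) (r : R) : 'rV[R]_2 :=
  let q : R := if s.2 then 1 else -1 in
  if s.1 == ord0 then pt q r else pt r q.

                                                                               
                                                                               
                                                                            
                                                                              
                                                                   
Record mesh (S : set 'rV[R]_3) := Mesh {
  elt : finType;
  chart : elt -> 'rV[R]_2 -> 'rV[R]_3;
  nbr : elt -> side -> elt * side * bool;
  mesh_chart : forall k, element_map (chart k);
  mesh_cover : S = \bigcup_k (chart k @` square);
  mesh_nbr_neq : forall k s, (nbr k s).1.1 != k;
  mesh_nbr : forall k s (r : R), -1 <= r <= 1 ->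
    let: (k', s', flip) := nbr k s in
    chart k (side_pt s r) = chart k' (side_pt s' (if flip then - r else r));
  mesh_conform : forall k k' x y, square x -> square y -> k != k' ->
    chart k x = chart k' y ->
    (exists s (r : R) s' flip, [/\ nbr k s = (k', s', flip), -1 <= r <= 1,
       x = side_pt s r & y = side_pt s' (if flip then - r else r)])
    \/ ((forall a, `|x 0 a| = 1) /\ (forall a, `|y 0 a| = 1)) }.

End Geometry.

Section LocalState.
Context {R : realType}.

                                                                              
                                               
Record state := State {
  dep : R;
  vel : 'I_2 -> R;
  bot : R;
  cor : R;
  gcov : 'M[R]_2;
  gam : 'I_2 -> 'I_2 -> 'I_2 -> R }.

Definition gcon (p : state) : 'M[R]_2 := invmx (gcov p).
Definition jac (p : state) : R := Num.sqrt (\det (gcov p)).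
Definition covel (p : state) (i : 'I_2) : R :=
  \sum_(j < 2) gcov p i j * vel p j.

Definition tau (g : R) (p : state) (i j : 'I_2) : R :=
  dep p * vel p i * vel p j + g / 2 * dep p ^+ 2 * gcon p i j.

Definition vec3 (a : R) (w : 'I_2 -> R) : 'cV[R]_3 :=
  \col_c (if unlift ord0 c is Some i then w i else a).

                                           
Definition Jflux (g : R) (j : 'I_2) (p : state) : 'cV[R]_3 :=
  jac p *: vec3 (dep p * vel p j) (fun i => tau g p i j).

Definition two_point : Type := 'I_2 -> state -> state -> 'cV[R]_3.

Definition ec_flux (g : R) : two_point := fun j L Rt =>
  vec3
    (2^-1 * (jac L * dep L * vel L j + jac Rt * dep Rt * vel Rt j))
    (fun i =>
      4^-1 * (jac L * dep L * vel L j * vel L i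
              + jac Rt * dep Rt * vel Rt j * vel Rt i
              + jac Rt * dep Rt * vel Rt j * vel L i
              + \sum_(k < 2)
                  gcon L i k * jac L * dep L * vel L j * covel Rt k)
      + g / 2 * (gcon L i j * jac L * dep L) * dep Rt
      + g / 2 * (gcon L i j * jac L * dep L) * (bot Rt - bot L)).

Definition ec_source (p : state) : 'cV[R]_3 :=
  vec3 0 (fun i =>
    - (2^-1 * (\sum_(j < 2) \sum_(k < 2) gam p i j k * dep p * vel p j * vel p k
               - \sum_(j < 2) \sum_(k < 2) \sum_(l < 2)
                   gcon p i k * gam p l j k * dep p * vel p j * covel p l))
    - \sum_(j < 2) \sum_(k < 2)
        cor p * jac p * gcon p i j * eps j k * dep p * vel p k).

                                                                    
Definition swe_rhs (g : R) (P : 'rV[R]_2 -> state) (x : 'rV[R]_2) : 'cV[R]_3 :=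
  let p := P x in
  vec3
    (- ((jac p)^-1 *
        \sum_(j < 2) pd j (fun y => jac (P y) * dep (P y) * vel (P y) j) x))
    (fun i =>
      - ((jac p)^-1 * \sum_(j < 2) pd j (fun y => jac (P y) * tau g (P y) i j) x)
      - \sum_(j < 2) \sum_(k < 2)
          cor p * jac p * gcon p i j * eps j k * dep p * vel p k
      - \sum_(j < 2) g * dep p * gcon p i j * pd j (fun y => bot (P y)) x
      - \sum_(j < 2) \sum_(k < 2) gam p i j k * tau g p j k).

                                                                         
                                                                             
                                                                          
Inductive aexpr :=
  | ACst of R
  | ADep
  | AVel of 'I_2
  | ABot
  | ACor
  | AJac
  | AGcov of 'I_2 & 'I_2
  | AGcon of 'I_2 & 'I_2
  | AGam of 'I_2 & 'I_2 & 'I_2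
  | AAdd of aexpr & aexpr
  | AMul of aexpr & aexpr
  | AInv of aexpr.

Inductive dexpr :=
  | DAlg of aexpr
  | DPartial of 'I_2 & aexpr
  | DAdd of dexpr & dexpr
  | DMul of dexpr & dexpr.

Fixpoint aeval (e : aexpr) (p : state) : R :=
  match e with
  | ACst c => c
  | ADep => dep p
  | AVel i => vel p i
  | ABot => bot p
  | ACor => cor p
  | AJac => jac p
  | AGcov i j => gcov p i j
  | AGcon i j => gcon p i j
  | AGam i j k => gam p i j k
  | AAdd e1 e2 => aeval e1 p + aeval e2 p
  | AMul e1 e2 => aeval e1 p * aeval e2 p
  | AInv e1 => (aeval e1 p)^-1
  end.

                                                                            
                                                    
Fixpoint deval (T : Type) (del : 'I_2 -> (T -> R) -> T -> R) (P : T -> state)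
    (e : dexpr) (x : T) : R :=
  match e with
  | DAlg a => aeval a (P x)
  | DPartial i a => del i (fun y => aeval a (P y)) x
  | DAdd e1 e2 => deval del P e1 x + deval del P e2 x
  | DMul e1 e2 => deval del P e1 x * deval del P e2 x
  end.

End LocalState.

Arguments state : clear implicits.
Arguments two_point : clear implicits.
Arguments aexpr : clear implicits.
Arguments dexpr : clear implicits.

Section Nodes.
Context {R : realType} {N : nat}.
Implicit Types (xi omega : 'I_N.+1 -> R).

                        
Definition legendre (n : nat) : {poly R} :=
  ((2 ^ n * n`!)%:R)^-1 *: derivn n (('X ^+ 2 - 1) ^+ n).

Definition lagr xi (j : 'I_N.+1) : {poly R} :=
  \prod_(k < N.+1 | k != j) ((xi j - xi k)^-1 *: ('X - (xi k)%:P)).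

(* Increasing nodes at the N + 1 zeros of (1 - x^2) P_N'(x), with the weights of
   interpolatory quadrature (which are in fact always positive). *)
Record LGL xi omega : Prop := {
  LGL_N : (0 < N)%N;
  LGL_incr : forall i j : 'I_N.+1, (i < j)%N -> xi i < xi j;
  LGL_root : forall i, root ((1 - 'X ^+ 2) * deriv (legendre N)) (xi i);
  LGL_weight : forall i, omega i =
    Rintegral lebesgue_measure `[-1, 1] (fun x : R => (lagr xi i).[x]);
  LGL_weight_gt0 : forall i, 0 < omega i }.

Definition Dmat xi : 'M[R]_N.+1 := \matrix_(i, j) (deriv (lagr xi j)).[xi i].
Definition Mmat omega : 'M[R]_N.+1 := diag_mx (\row_i omega i).
Definition Qmat xi omega : 'M[R]_N.+1 := Mmat omega *m Dmat xi.
Definition Bmat : 'M[R]_N.+1 :=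
  diag_mx (\row_i ((i == ord_max)%:R - (i == ord0)%:R)).
Definition Smat xi omega : 'M[R]_N.+1 := 2%:R *: Qmat xi omega - Bmat.

Definition node : Type := ('I_N.+1 * 'I_N.+1)%type.

Definition sbp xi (a : 'I_2) (phi : node -> R) (n : node) : R :=
  if a == ord0 then \sum_(m < N.+1) Dmat xi n.1 m * phi (m, n.2)
  else \sum_(m < N.+1) Dmat xi n.2 m * phi (n.1, m).

Definition side_node (s : side) (m : 'I_N.+1) : node :=
  let q : 'I_N.+1 := if s.2 then ord_max else ord0 in
  if s.1 == ord0 then (q, m) else (m, q).

End Nodes.

Arguments node : clear implicits.

Section Scheme.
Context {R : realType} (g : R).
Context (Fvol Fint : two_point R) (src : state R -> 'cV[R]_3).
Context {S : set 'rV[R]_3} (M : mesh S).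
Context {N : nat} (xi omega : 'I_N.+1 -> R).
Context (f : elt M -> 'rV[R]_2 -> R) (b : elt M -> node N -> R).

                                            
Definition nodal : Type := elt M -> node N -> 'cV[R]_3.

Definition node_pt (n : node N) : 'rV[R]_2 := pt (xi n.1) (xi n.2).

Definition u_dep (u : 'cV[R]_3) : R := u ord0 0.
Definition u_mom (u : 'cV[R]_3) (i : 'I_2) : R := u (lift ord0 i) 0.

Definition geo_state (k : elt M) (n : node N) (h : R) (v : 'I_2 -> R) (z : R) :
    state R :=
  let x := node_pt n in
  State h v z (f k x) (metric (chart k) x) (christoffel (chart k) x).

Definition node_state (u : nodal) (k : elt M) (n : node N) : state R :=
  geo_state k n (u_dep (u k n))
    (fun i => u_mom (u k n) i / u_dep (u k n)) (b k n).

                                                                              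
                                                                          
Definition ext_elt (k : elt M) (s : side) : elt M := (nbr k s).1.1.
Definition ext_node (k : elt M) (s : side) (m : 'I_N.+1) : node N :=
  side_node (nbr k s).1.2 (if (nbr k s).2 then rev_ord m else m).

Definition tangent_vec (k : elt M) (n : node N) (w : 'I_2 -> R) : 'rV[R]_3 :=
  \sum_(i < 2) w i *: pd i (chart k) (node_pt n).

                                                                               
                                                                           
Definition local_comp (k : elt M) (n : node N) (w : 'rV[R]_3) (i : 'I_2) : R :=
  \sum_(j < 2) invmx (metric (chart k) (node_pt n)) i j
    * dotv (pd j (chart k) (node_pt n)) w.

                                                                          
                                  
Definition ext_state (u : nodal) (k : elt M) (s : side) (m : 'I_N.+1) :
    state R :=
  let n := side_node s m in
  let k' := ext_elt k s in
  let n' := ext_node k s m in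
  let h' := u_dep (u k' n') in
  let mom := local_comp k n (tangent_vec k' n' (u_mom (u k' n'))) in
  geo_state k n h' (fun i => mom i / h') (b k' n').

Definition int_flux (u : nodal) (k : elt M) (s : side) (m : 'I_N.+1) :
    'cV[R]_3 :=
  Fint s.1 (node_state u k (side_node s m)) (ext_state u k s m).

Definition bracket (u : nodal) (k : elt M) (s : side) (m : 'I_N.+1) :
    'cV[R]_3 :=
  int_flux u k s m - Jflux g s.1 (node_state u k (side_node s m)).

                                                     
                                                     
Definition flux_diff_rhs (u : nodal) (k : elt M) (n : node N) : 'cV[R]_3 :=
  let: (i, j) := n in
  let P := node_state u k in
  let x1 : 'I_2 := ord0 in
  let x2 : 'I_2 := ord_max in
  omega j *: (- \sum_(m < N.+1) Smat xi omega i m *: Fvol x1 (P (i, j)) (P (m, j))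
              + (i == ord0)%:R *: int_flux u k (x1, false) j
              - (i == ord_max)%:R *: int_flux u k (x1, true) j)
  + omega i *: (- \sum_(m < N.+1) Smat xi omega j m *: Fvol x2 (P (i, j)) (P (i, m))
              + (j == ord0)%:R *: int_flux u k (x2, false) i
              - (j == ord_max)%:R *: int_flux u k (x2, true) i)
  + (omega i * omega j * jac (P (i, j))) *: src (P (i, j)).

                                    
Definition strong_volume (u : nodal) (k : elt M) (n : node N) : 'cV[R]_3 :=
  let: (i, j) := n in
  let P := node_state u k in
  - ((jac (P (i, j)))^-1 *:
       \sum_(m < N.+1) (2 * Dmat xi i m) *: Fvol ord0 (P (i, j)) (P (m, j)))
  - ((jac (P (i, j)))^-1 *:
       \sum_(m < N.+1) (2 * Dmat xi j m) *: Fvol ord_max (P (i, j)) (P (i, m)))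
  + src (P (i, j)).

Definition strong_interface (u : nodal) (k : elt M) (n : node N) : 'cV[R]_3 :=
  let: (i, j) := n in
  let w := jac (node_state u k (i, j)) * omega i * omega j in
  let x1 : 'I_2 := ord0 in
  let x2 : 'I_2 := ord_max in
  ((i == ord0)%:R / w) *: (omega j *: bracket u k (x1, false) j)
  - ((i == ord_max)%:R / w) *: (omega j *: bracket u k (x1, true) j)
  + ((j == ord0)%:R / w) *: (omega i *: bracket u k (x2, false) i)
  - ((j == ord_max)%:R / w) *: (omega i *: bracket u k (x2, true) i).

Definition solves_scheme (u : R -> nodal) (t : R) : Prop :=
  forall k n, derivable (fun s => u s k n) t 1 /\
    (omega n.1 * omega n.2 * jac (node_state (u t) k n))
      *: derive1 (fun s => u s k n) t
    = flux_diff_rhs (u t) k n.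

Definition solves_strong (u : R -> nodal) (t : R) : Prop :=
  forall k n, derivable (fun s => u s k n) t 1 /\
    derive1 (fun s => u s k n) t
    = strong_volume (u t) k n + strong_interface (u t) k n.

                                                                             
                     
Definition continuous_across (u : nodal) : Prop :=
  forall k s m,
    let n := side_node s m in
    let k' := ext_elt k s in
    let n' := ext_node k s m in
    [/\ dep (node_state u k n) = dep (node_state u k' n'),
        tangent_vec k n (vel (node_state u k n))
          = tangent_vec k' n' (vel (node_state u k' n'))
      & b k n = b k' n'].

End Scheme.

Definition field_state {R : realType} (X : 'rV[R]_2 -> 'rV[R]_3)
    (f h : 'rV[R]_2 -> R) (v : 'I_2 -> 'rV[R]_2 -> R) (b : 'rV[R]_2 -> R)
    (x : 'rV[R]_2) : state R :=
  State (h x) (v^~ x) (b x) (f x) (metric X x) (christoffel X x).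

                                                                           
                                           
Definition represents_swe {R : realType} (g : R) (E : 'I_3 -> dexpr R) : Prop :=
  forall (X : 'rV[R]_2 -> 'rV[R]_3) (f h : 'rV[R]_2 -> R)
         (v : 'I_2 -> 'rV[R]_2 -> R) (b : 'rV[R]_2 -> R),
    element_map X -> smooth h -> (forall i, smooth (v i)) -> smooth b ->
    (forall x, square x -> 0 < h x) ->
    forall x, square x ->
      \col_c deval pd (field_state X f h v b) (E c) x
      = swe_rhs g (field_state X f h v b) x.

                                                                              
Definition consistent_discretization {R : realType} (g : R)
    (Fvol Fint : two_point R) (src : state R -> 'cV[R]_3) : Prop :=
  exists E : 'I_3 -> dexpr R, represents_swe g E /\
    forall (S : set 'rV[R]_3) (M : mesh S) (N : nat) (xi omega : 'I_N.+1 -> R)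
           (f : elt M -> 'rV[R]_2 -> R) (b : elt M -> node N -> R)
           (u : R -> nodal M (N := N)) (t : R),
      LGL xi omega ->
      (forall k n, 0 < u_dep (u t k n)) ->
      [/\ solves_scheme Fvol Fint src xi omega f b u t
            <-> solves_strong g Fvol Fint src xi omega f b u t,
          continuous_across xi f b (u t) ->
            forall k s m, bracket g Fint xi f b (u t) k s m = 0
        & forall k n, strong_volume Fvol src xi f b (u t) k n
            = \col_c deval (sbp xi) (node_state xi f b (u t) k) (E c) n].

(* Main.v *)
Require Import Defs.
From mathcomp Require Import all_boot all_order all_algebra.
From mathcomp Require Import all_classical all_reals all_analysis.
From mathcomp Require Import ring.
Import Order.TTheory GRing.Theory Num.Theory.
Import numFieldNormedType.Exports.
Local Open Scope ring_scope.

(** The volume sum 2 D_im phi(L, R_m), with L the node at which the equation is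
    written, acts on the R-dependence of the two-point flux only: since the rows
    of D sum to zero, a term depending on L alone disappears, and a product of a
    left factor with a right factor becomes the left factor times the nodal
    derivative of the right one.  The flux differencing therefore discretizes,
    with no further approximation, the split form
<<
      - 1/J sum_j [ 1/2 ( d_j (J h v^j v^i) + v^i d_j (J h v^j)
                          + G^ik J h v^j d_j v_k )
                    + g G^ij J h (d_j h + d_j b) ] + s^i,
>>
    called [split_rhs] below for an arbitrary family of operators d_j
    ([strong_volume_split]).  The same formal expression ([split_expr]) is
    evaluated with nodal derivatives in the scheme and with partial derivatives
    on smooth fields.

    On smooth fields the split form is the shallow water system
    ([split_rhs_pd]), because of two identities for the metric.
    - Writing v_k = G_kl v^l, the expression G^ik d_j v_k differs from d_j v^i by
      G^ik (d_j G_kl) v^l, and the metric compatibility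
      d_j G_kl = G_km Gamma^m_jl + G_lm Gamma^m_jk turns this into
      Gamma^i_jk v^k + G^ik Gamma^l_jk v_l ([metric_compatibility]).  Half of it
      is added by the covariant third of the advective split, and the source term
      is chosen to leave exactly Gamma^i_jk h v^j v^k ([momentum_balance]).
    - The pressure is split by the product rule, and
      d_j (J G^ij) = - J Gamma^i_jk G^jk ([divergence_metric]) cancels the
      pressure part of the Christoffel term.

    The equivalence of the two forms of the scheme is the relation S = 2 Q - B
    together with the consistency of the flux, phi^j(p, p) = J f^j
    ([flux_diff_strong]).  When the data are continuous across an interface, the
    external state is, once expressed in the local basis, equal to the internal
    one ([ext_state_continuous]), so that the same consistency makes the
    interface brackets vanish.  All of this requires invertible metrics at the
    nodes, hence that the Legendre-Gauss-Lobatto nodes lie in [-1, 1]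
    ([LGL_node_square]). *)

(** * Legendre-Gauss-Lobatto nodes and the differentiation matrix *)

Lemma derivn_comp_affine {R : realType} (p : {poly R}) (s c : R) n :
  derivn n (p \Po (s *: 'X + c%:P)) = s ^+ n *: (derivn n p \Po (s *: 'X + c%:P)).
Proof.
elim: n => [|n IHn]; first by rewrite !derivn0 expr0 scale1r.
rewrite !derivnS IHn derivZ deriv_comp derivD derivC addr0 derivZ derivX.
by rewrite -scalerAr mulr1 scalerA -exprSr.
Qed.

Lemma horner_nneg_gt0 {R : realType} (p : {poly R}) (i : nat) (y : R) :
  (forall k, 0 <= p`_k) -> 0 < p`_i -> 0 < y -> 0 < p.[y].
Proof.
move=> p_ge0 pi_gt0 y_gt0; have i_lt : (i < size p)%N.
  by rewrite ltnNge; apply/negP => /(nth_default 0) p0; rewrite p0 ltxx in pi_gt0.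
rewrite horner_coef (bigD1 (Ordinal i_lt)) //=.
apply: ltr_pwDl; first by rewrite mulr_gt0 ?exprn_gt0.
by apply: sumr_ge0 => k _; rewrite mulr_ge0 ?exprn_ge0 ?(ltW y_gt0).
Qed.

(** With s the sign of x and y = |x| - 1, the substitution X := s X + s changes
    (X^2 - 1)^N into (X^2 + 2 X)^N, whose derivatives have nonnegative
    coefficients; up to order 2 N they are nonzero, hence positive at y > 0. *)
Lemma derivn_rodrigues_root {R : realType} (N n : nat) (x : R) :
  (n <= N.*2)%N -> root (derivn n (('X ^+ 2 - 1) ^+ N)) x -> `|x| <= 1.
Proof.
move=> n_le /rootP x_root; rewrite leNgt; apply/negP => x_gt1.
set s := Num.sg x; set y := `|x| - 1.
have x_neq0 : x != 0 by rewrite -normr_gt0; apply: lt_trans x_gt1.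
have ss : s * s = 1 by rewrite -expr2 sqr_sg x_neq0.
have xE : x = s * y + s by rewrite /y mulrBr mulr1 subrK -numEsg.
pose q : {poly R} := ('X ^+ 2 + 2%:R *: 'X) ^+ N.
have qE : (('X ^+ 2 - 1) ^+ N) \Po (s *: 'X + s%:P) = q.
  rewrite rmorphXn rmorphB rmorphXn /= comp_polyX rmorph1 /q; congr (_ ^+ _).
  rewrite -!mul_polyC rmorph_nat.
  transitivity ((s * s)%:P * ('X ^+ 2 + 2%:R * 'X + 1) - 1 : {poly R}).
    by rewrite rmorphM; ring.
  by rewrite ss; ring.
have q_nneg : q \is a polyOver (@Num.Def.nneg_num_pred R).
  apply: rpredX; apply: rpredD; first exact/rpredX/polyOverX.
  by apply: polyOverZ; rewrite ?polyOverX //= unfold_in /= ?ler0n.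
(* X^N factors out, so that this is the leading coefficient of (X + 2)^N. *)
have q_lead : q`_N.*2 = 1.
  have -> : q = 'X ^+ N * ('X + 2%:R%:P) ^+ N.
    by rewrite /q -exprMn -mul_polyC; congr (_ ^+ _); ring.
  have sz : size (('X + 2%:R%:P : {poly R}) ^+ N) = N.+1.
    by rewrite -(opprK 2%:R) polyCN size_exp_XsubC.
  rewrite coefXnM -addnn ltnNge leq_addr /= addnK -[N in _`_N]/(N.+1.-1) -sz.
  by apply/monicP; rewrite -(opprK 2%:R) polyCN; exact/monic_exp/monicXsubC.
have : 0 < (derivn n q).[y].
  apply: (@horner_nneg_gt0 _ _ (N.*2 - n)%N); last by rewrite subr_gt0.
    by move=> k; have /polyOverP := polyOver_derivn q_nneg n; exact.
  by rewrite coef_derivn subnKC // q_lead ltr0n ffact_gt0.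
rewrite -qE derivn_comp_affine hornerZ horner_comp !hornerE -xE x_root mulr0.
by rewrite ltxx.
Qed.

Lemma LGL_node_square {R : realType} {N : nat} (xi omega : 'I_N.+1 -> R) i :
  LGL xi omega -> -1 <= xi i <= 1.
Proof.
move=> [N_gt0 _ /(_ i) xi_root _ _]; rewrite -ler_norml.
move: xi_root; rewrite rootM => /orP[|].
  by rewrite rootE !hornerE subr_eq0 eq_sym sqrf_eq1 => /orP[]/eqP->;
    rewrite ?normrN normr1.
rewrite derivZ rootZ; last first.
  by rewrite invr_eq0 pnatr_eq0 muln_eq0 expn_eq0 -lt0n fact_gt0.
rewrite -derivnS; apply: derivn_rodrigues_root.
by rewrite -addnn -addn1 leq_add2l.
Qed.

(** The Lagrange polynomials form a partition of unity: their sum minus 1 has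
    degree at most N and vanishes at N + 1 distinct nodes. *)
Lemma Dmat_sum {R : realType} {N : nat} (xi omega : 'I_N.+1 -> R) i :
  LGL xi omega -> \sum_(m < N.+1) Dmat xi i m = 0.
Proof.
move=> [_ xi_incr _ _ _].
have xi_inj : injective xi.
  move=> j k xi_eq; apply: ord_inj.
  by case: (ltngtP j k) => // /xi_incr; rewrite xi_eq ltxx.
have lagr_node j k : (lagr xi j).[xi k] = (j == k)%:R.
  rewrite /lagr horner_prod; have [<-|jk] := eqVneq j k.
    apply: big1 => l lj; rewrite !hornerE mulVf // subr_eq0.
    by apply: contra_neq lj => /xi_inj.
  by rewrite (bigD1 k) ?[k == j]eq_sym //= !hornerE subrr mulr0 mul0r.
have lagr_size j : (size (lagr xi j) <= N.+1)%N.
  rewrite /lagr scaler_prod; apply: leq_trans (size_scale_leq _ _) _.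
  rewrite -(big_enum _ _ (predC1 j) (fun k => 'X - (xi k)%:P)) /=.
  by rewrite size_prod_XsubC -cardE cardC1 card_ord.
have sum1 : \sum_m lagr xi m = 1.
  apply/eqP; rewrite -subr_eq0; apply/negP => /negP nz.
  have := @max_poly_roots _ _ [seq xi k | k <- enum 'I_N.+1] nz.
  rewrite size_map size_enum_ord (map_inj_uniq xi_inj) enum_uniq.
  have -> : all (root (\sum_m lagr xi m - 1)) [seq xi k | k <- enum 'I_N.+1].
    apply/allP => _ /mapP[k _ ->]; rewrite rootE !hornerE horner_sum.
    rewrite (bigD1 k) //= lagr_node eqxx big1 ?addr0 ?subrr // => m /negbTE mk.
    by rewrite lagr_node mk.
  move=> /(_ isT isT); rewrite ltnNge => /negP; apply.
  apply: leq_trans (size_polyD _ _) _; rewrite size_polyN size_poly1 geq_max andbT.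
  apply: leq_trans (size_sum _ _ _) _.
  by apply/bigmax_leqP => j _.
transitivity ((\sum_m lagr xi m)^`().[xi i]); last by rewrite sum1 derivC horner0.
by rewrite raddf_sum horner_sum; apply: eq_bigr => m _; rewrite mxE.
Qed.

(** * Two-dimensional linear algebra *)

Lemma sum2 {V : nmodType} (F : 'I_2 -> V) : \sum_(j < 2) F j = F ord0 + F ord_max.
Proof. by rewrite big_ord_recl big_ord1; congr (_ + F _); apply: val_inj. Qed.

Lemma ord2P (P : 'I_2 -> Prop) : P ord0 -> P ord_max -> forall i, P i.
Proof.
move=> P0 P1 [[|[|//]] lti].
  by rewrite (_ : Ordinal lti = ord0) //; apply: val_inj.
by rewrite (_ : Ordinal lti = ord_max) //; apply: val_inj.
Qed.

Lemma det2 {R : comNzRingType} (A : 'M[R]_2) :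
  \det A = A ord0 ord0 * A ord_max ord_max - A ord0 ord_max * A ord_max ord0.
Proof.
rewrite (expand_det_row _ ord0) sum2 /cofactor !det_mx11 !mxE /= expr0 mul1r.
rewrite expr1 mulN1r mulrN; congr (_ * A _ _ - _ * A _ _); exact: val_inj.
Qed.

(** The entries of the adjugate, without going through cofactors: they are
    linear in A for 2 x 2 matrices, hence commute with differentiation. *)
Definition adj2 {R : pzRingType} (A : 'M[R]_2) (i j : 'I_2) : R :=
  if i == j then A (rev_ord i) (rev_ord i) else - A i j.

Lemma invmx2 {R : fieldType} (A : 'M[R]_2) i j :
  \det A != 0 -> invmx A i j = adj2 A i j / \det A.
Proof.
move=> dA; pose B : 'M[R]_2 := \matrix_(i, j) (adj2 A i j / \det A).
suff /(congr1 (mulmx (invmx A))) : A *m B = 1%:M.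
  by rewrite mulmx1 mulKmx ?unitmxE ?unitfE // => <-; rewrite mxE.
have r0 : rev_ord ord0 = ord_max :> 'I_2 by exact: val_inj.
have r1 : rev_ord ord_max = ord0 :> 'I_2 by exact: val_inj.
apply/matrixP => k l; rewrite !mxE sum2 !mxE /adj2.
move: dA; rewrite det2 => dA.
by move: k l; do 2 apply: ord2P; rewrite /= ?r0 ?r1; field.
Qed.

Lemma mulVmx_coef {F : fieldType} {n : nat} (A : 'M[F]_n) i k :
  \det A != 0 -> \sum_(l < n) invmx A i l * A l k = (i == k)%:R.
Proof.
move=> dA; have /mulVmx/matrixP/(_ i k) : A \in unitmx by rewrite unitmxE unitfE.
by rewrite !mxE.
Qed.

Lemma invmx_contract {F : fieldType} {n : nat} (A : 'M[F]_n) (w : 'I_n -> F) i :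
  \det A != 0 -> \sum_(k < n) invmx A i k * (\sum_(l < n) A k l * w l) = w i.
Proof.
move=> dA; under eq_bigr do rewrite mulr_sumr.
rewrite exchange_big /= (bigD1 i) //= [X in _ + X]big1 ?addr0 => [|l li].
  by under eq_bigr do rewrite mulrA; rewrite -mulr_suml mulVmx_coef // eqxx mul1r.
under eq_bigr do rewrite mulrA.
by rewrite -mulr_suml mulVmx_coef // eq_sym (negbTE li) mul0r.
Qed.

Lemma vec3_lift {R : realType} (a : R) w i : vec3 a w (lift ord0 i) 0 = w i.
Proof. by rewrite mxE liftK. Qed.

Lemma vec3_ord0 {R : realType} (a : R) w : vec3 a w ord0 0 = a.
Proof. by rewrite mxE unlift_none. Qed.

(** * Partial derivatives and the metric of an element *)

Section Calculus.
Context {R : realType}.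
Implicit Types (phi psi : 'rV[R]_2 -> R) (x : 'rV[R]_2) (a : 'I_2).

Lemma pdD a phi psi x : differentiable phi x -> differentiable psi x ->
  pd a (fun y => phi y + psi y) x = pd a phi x + pd a psi x.
Proof. by move=> dphi dpsi; apply: deriveD; exact: diff_derivable. Qed.

Lemma pdM a phi psi x : differentiable phi x -> differentiable psi x ->
  pd a (fun y => phi y * psi y) x = pd a phi x * psi x + phi x * pd a psi x.
Proof.
move=> dphi dpsi; rewrite /pd (@deriveM _ _ phi psi); [|exact: diff_derivable..].
by rewrite addrC mulrC.
Qed.

Lemma pdZ a (c : R) phi x : differentiable phi x ->
  pd a (fun y => c * phi y) x = c * pd a phi x.
Proof.
move=> dphi; rewrite (pdM a (cst c)) //.
by rewrite (_ : pd a (cst c) x = 0) ?mul0r ?add0r //; exact: derive_cst.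
Qed.

Lemma pdN a phi x : differentiable phi x -> pd a (fun y => - phi y) x = - pd a phi x.
Proof. by move=> dphi; apply: deriveN; exact: diff_derivable. Qed.

Lemma pdV a phi x : phi x != 0 -> differentiable phi x ->
  pd a (fun y => (phi y)^-1) x = - (pd a phi x / phi x ^+ 2).
Proof.
move=> nz dphi; rewrite /pd deriveV //; last exact: diff_derivable.
by rewrite scaleNr [_ *: _]mulrC.
Qed.

Lemma smooth_differentiable {V : normedModType R} (phi : 'rV[R]_2 -> V) x :
  smooth phi -> square x -> differentiable phi x.
Proof. by case=> U [_ sU dphi] sx; apply: (dphi [::]); apply: sU. Qed.

Lemma smooth_pd_differentiable {V : normedModType R} (phi : 'rV[R]_2 -> V) a x :
  smooth phi -> square x -> differentiable (pd a phi) x.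
Proof. by case=> U [_ sU dphi] sx; apply: (dphi [:: a]); apply: sU. Qed.

Lemma metricE (X : 'rV[R]_2 -> 'rV[R]_3) x i j :
  metric X x i j = \sum_(c < 3) pd i X x 0 c * pd j X x 0 c.
Proof. by rewrite mxE /dotv mxE; apply: eq_bigr => c _; rewrite mxE. Qed.

Lemma metricC (X : 'rV[R]_2 -> 'rV[R]_3) x i j : metric X x i j = metric X x j i.
Proof. by rewrite !metricE; apply: eq_bigr => c _; rewrite mulrC. Qed.

Lemma differentiable_metric (X : 'rV[R]_2 -> 'rV[R]_3) x i j :
  smooth X -> square x -> differentiable (fun y => metric X y i j) x.
Proof.
move=> smX sx.
have dX k c : differentiable (fun y => pd k X y 0 c) x.
  apply: (@differentiable_comp _ _ _ _ (pd k X) (fun w : 'rV[R]_3 => w 0 c)).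
    exact: smooth_pd_differentiable.
  exact: differentiable_coord.
have -> : (fun y => metric X y i j)
    = \sum_(c < 3) ((fun y => pd i X y 0 c) * (fun y => pd j X y 0 c)).
  by apply/funext => y; rewrite metricE fct_sumE.
by apply: differentiable_sum => c; apply: differentiableM.
Qed.

Lemma det_posdef2_gt0 (G : 'M[R]_2) : G ord_max ord0 = G ord0 ord_max ->
  (forall w : 'rV[R]_2, w != 0 -> 0 < (w *m G *m w^T) 0 0) -> 0 < \det G.
Proof.
move=> Gsym posG.
have quadE (w : 'rV[R]_2) : (w *m G *m w^T) 0 0 =
    G ord0 ord0 * w 0 ord0 ^+ 2 + 2 * G ord0 ord_max * w 0 ord0 * w 0 ord_max
    + G ord_max ord_max * w 0 ord_max ^+ 2.
  by rewrite mxE sum2 !mxE !sum2 Gsym; ring.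
have G00 : 0 < G ord0 ord0.
  have := posG (pt 1 0); rewrite quadE !mxE /= expr1n mulr1 mulr0 expr0n mulr0 !addr0.
  by apply; apply/eqP => /rowP/(_ ord0)/eqP; rewrite !mxE /= oner_eq0.
rewrite det2 -(pmulr_rgt0 _ G00).
(* The quadratic form takes the value G_00 det G at (- G_01, G_00). *)
have := posG (pt (- G ord0 ord_max) (G ord0 ord0)); rewrite quadE !mxE /= Gsym.
move=> pos; apply: lt_le_trans (pos _) _.
  by apply/eqP => /rowP/(_ ord_max)/eqP; rewrite !mxE /= gt_eqF.
by rewrite le_eqVlt; apply/orP; left; apply/eqP; ring.
Qed.

Lemma det_metric_gt0 (X : 'rV[R]_2 -> 'rV[R]_3) x :
  element_map X -> square x -> 0 < \det (metric X x).
Proof.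
by case=> _ _ posG sx; apply: det_posdef2_gt0 (posG x sx); exact: metricC.
Qed.

End Calculus.

(** * Metric identities *)

Section MetricAlgebra.
Context {R : realType}.
Implicit Types (G : 'M[R]_2) (d : 'I_2 -> 'M[R]_2).

(** The differential of the determinant at G, applied to D. *)
Definition det_diff G (D : 'M[R]_2) : R :=
  D ord0 ord0 * G ord_max ord_max + G ord0 ord0 * D ord_max ord_max
  - (D ord0 ord_max * G ord_max ord0 + G ord0 ord_max * D ord_max ord0).

(** Christoffel symbols in terms of the metric and a candidate [d j] for its
    partial derivatives, in order to separate the algebra from the calculus. *)
Definition christoffel_of G d (i j k : 'I_2) : R :=
  2^-1 * \sum_(l < 2) invmx G i l * (d j k l + d k j l - d l j k).

(** The summand on the left is the derivative of J G^ij = adj(G)^ij / J, with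
    d_j J = d_j (det G) / (2 J). *)
Lemma contracted_christoffel G d (J : R) i :
  (forall k l, G k l = G l k) -> (forall j k l, d j k l = d j l k) ->
  J != 0 -> J * J = \det G ->
  \sum_(j < 2) (adj2 (d j) i j / J - adj2 G i j * (det_diff G (d j) / (2 * J)) / J ^+ 2)
  = - (J * \sum_(j < 2) \sum_(k < 2) christoffel_of G d i j k * invmx G j k).
Proof.
move=> Gsym dsym J0 JJ; have dG : \det G != 0 by rewrite -JJ mulf_neq0.
(* Over the common denominator J^3 the numerators agree as polynomials in the
   entries of G and d, once J^2 is replaced by det G. *)
transitivity ((\sum_(j < 2)
      (adj2 (d j) i j * \det G - adj2 G i j * (det_diff G (d j) / 2)))
    / J ^+ 3).
  rewrite mulr_suml; apply: eq_bigr => j _; rewrite -JJ; field => //.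
transitivity (- (\sum_(j < 2) \sum_(k < 2) 2^-1 * (\sum_(l < 2) adj2 G i l *
    (d j k l + d k j l - d l j k)) * adj2 G j k) / J ^+ 3); last first.
  rewrite mulNr mulr_sumr mulr_suml; congr (- _); apply: eq_bigr => j _.
  rewrite mulr_sumr mulr_suml; apply: eq_bigr => k _.
  rewrite /christoffel_of !sum2 !invmx2 // -JJ; field => //.
congr (_ / _); rewrite !sum2 det2 /det_diff /adj2.
have r0 : rev_ord ord0 = ord_max :> 'I_2 by exact: val_inj.
have r1 : rev_ord ord_max = ord0 :> 'I_2 by exact: val_inj.
rewrite ![G ord_max ord0]Gsym ![d _ ord_max ord0]dsym.
by move: i; apply: ord2P; rewrite /= ?r0 ?r1 ?[G ord_max ord0]Gsym
  ?[d ord0 ord_max ord0]dsym ?[d ord_max ord_max ord0]dsym; field.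
Qed.

(** This is d_j G_kl = G_lm Gamma^m_jk + G_km Gamma^m_jl, contracted with
    G^ik v^l. *)
Lemma metric_compatibility G d (v : 'I_2 -> R) i j :
  \det G != 0 ->
  (forall k l, G k l = G l k) -> (forall j k l, d j k l = d j l k) ->
  \sum_(k < 2) invmx G i k * (\sum_(l < 2) d j k l * v l)
  = \sum_(k < 2) (christoffel_of G d i j k * v k
     + \sum_(l < 2) invmx G i k * christoffel_of G d l j k
         * (\sum_(m < 2) G l m * v m)).
Proof.
move=> dG Gsym dsym.
rewrite /christoffel_of !sum2 !invmx2 // /adj2.
have r0 : rev_ord ord0 = ord_max :> 'I_2 by exact: val_inj.
have r1 : rev_ord ord_max = ord0 :> 'I_2 by exact: val_inj.
rewrite /= ?r0 ?r1.
move: dG; rewrite det2 [G ord_max ord0]Gsym => dG.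
rewrite ![d _ ord_max ord0]dsym.
by move: i j; do 2 apply: ord2P; rewrite /= ?r0 ?r1 ?[G ord_max ord0]Gsym
  ?[d ord0 ord_max ord0]dsym ?[d ord_max ord_max ord0]dsym; field.
Qed.

End MetricAlgebra.

Section MetricCalculus.
Context {R : realType}.
Context (X : 'rV[R]_2 -> 'rV[R]_3) (x : 'rV[R]_2).
Context (mapX : element_map X) (sx : square x).
Let G := metric X.
Let J y := Num.sqrt (\det (G y)).
Definition dmetric j : 'M[R]_2 := \matrix_(k, l) pd j (fun y => metric X y k l) x.

Lemma dmetricE j k l : dmetric j k l = pd j (fun y => metric X y k l) x.
Proof. by rewrite mxE. Qed.

Let smX : smooth X. Proof. by case: mapX. Qed.

Lemma differentiable_det_metric : differentiable (fun y => \det (metric X y)) x.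
Proof.
have -> : (fun y => \det (metric X y)) =
    (fun y => metric X y ord0 ord0) * (fun y => metric X y ord_max ord_max)
  - (fun y => metric X y ord0 ord_max) * (fun y => metric X y ord_max ord0).
  by apply/funext => y; rewrite det2.
apply: differentiableB; apply: differentiableM; exact: differentiable_metric.
Qed.

Lemma pd_det_metric j :
  pd j (fun y => \det (metric X y)) x = det_diff (metric X x) (dmetric j).
Proof.
have dG k l : differentiable (fun y => metric X y k l) x.
  exact: differentiable_metric.
have -> : (fun y => \det (metric X y)) =
    (fun y => metric X y ord0 ord0 * metric X y ord_max ord_max
              + - (metric X y ord0 ord_max * metric X y ord_max ord0)).
  by apply/funext => y; rewrite det2.
rewrite pdD ?pdN ?pdM //; first by rewrite /det_diff !dmetricE.
- exact: differentiableM.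
- exact: differentiableM.
- by apply: differentiableN; exact: differentiableM.
Qed.

Lemma near_det_metric_gt0 : \near x, 0 < \det (metric X x).
Proof.
have := differentiable_continuous differentiable_det_metric.
by move=> /cvgr_gt; apply; exact: det_metric_gt0.
Qed.

Let J0 : J x != 0. Proof. by rewrite gt_eqF // sqrtr_gt0 det_metric_gt0. Qed.

Lemma differentiable_jacobian :
  differentiable (fun y => Num.sqrt (\det (metric X y))) x.
Proof.
apply: (@differentiable_comp _ _ _ _ (fun y => \det (metric X y)) Num.sqrt).
  exact: differentiable_det_metric.
apply/derivable1_diffP.
by have [] := is_derive1_sqrt (det_metric_gt0 X x mapX sx).
Qed.

(** Differentiating J^2 = det G, valid near x, avoids the chain rule for the
    square root. *)
Lemma pd_jacobian j :
  pd j J x = det_diff (metric X x) (dmetric j) / (2 * J x).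
Proof.
have dJ := differentiable_jacobian.
have : pd j (fun y => J y * J y) x = det_diff (metric X x) (dmetric j).
  rewrite -pd_det_metric; apply: near_eq_derive; near=> y.
  rewrite -expr2 sqr_sqrtr // ltW //; near: y; exact: near_det_metric_gt0.
rewrite pdM // => <-; rewrite [J x * _]mulrC; field; exact: J0.
Unshelve. all: by end_near. Qed.

Lemma differentiable_adj2_metric i j :
  differentiable (fun y => adj2 (metric X y) i j) x.
Proof.
rewrite /adj2; case: (i == j); first exact: differentiable_metric.
by apply: differentiableN; exact: differentiable_metric.
Qed.

Lemma pd_adj2_metric a i j :
  pd a (fun y => adj2 (metric X y) i j) x = adj2 (dmetric a) i j.
Proof.
rewrite /adj2; case: (i == j); first by rewrite dmetricE.
by rewrite pdN ?dmetricE //; exact: differentiable_metric.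
Qed.

Lemma christoffelE i j k :
  christoffel X x i j k = christoffel_of (metric X x) dmetric i j k.
Proof.
rewrite /christoffel /christoffel_of; congr (_ * _); apply: eq_bigr => l _.
by rewrite -!dmetricE.
Qed.

(** Near x the quotient under the derivative is J G^ij. *)
Lemma divergence_metric i :
  \sum_(j < 2) pd j (fun y => adj2 (metric X y) i j / J y) x
  = - (J x * \sum_(j < 2) \sum_(k < 2)
        christoffel X x i j k * invmx (metric X x) j k).
Proof.
under [in RHS]eq_bigr do under eq_bigr do rewrite christoffelE.
rewrite -(@contracted_christoffel _ _ _ (J x) i) //.
- apply: eq_bigr => j _.
  have dJ := differentiable_jacobian.
  have dJV : differentiable (fun y => (J y)^-1) x by exact: differentiableV.
  have dK := differentiable_adj2_metric i j.
  rewrite pdM // (pdV _ _ _ J0 dJ) pd_jacobian pd_adj2_metric.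
  by rewrite mulrN !mulrA.
- by move=> k l; exact: metricC.
- by move=> j k l; rewrite !dmetricE; congr (pd j _ x);
    apply/funext => y; exact: metricC.
- by rewrite -expr2 sqr_sqrtr // ltW // det_metric_gt0.
Qed.

End MetricCalculus.

(** * The split form of the shallow water equations *)

(** The operators [del] are a parameter because the scheme evaluates this expression
    with nodal derivatives and the consistency argument with partial ones. *)
Definition split_rhs {R : realType} (g : R) {T : Type} (del : 'I_2 -> (T -> R) -> T -> R)
    (P : T -> state R) (x : T) : 'cV[R]_3 :=
  let p := P x in
  let flux j y := jac (P y) * dep (P y) * vel (P y) j in
  vec3
    (- ((jac p)^-1 * \sum_(j < 2) del j (flux j) x))
    (fun i =>
      - ((jac p)^-1 * \sum_(j < 2)
          (2^-1 * (del j (fun y => flux j y * vel (P y) i) x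
                   + vel p i * del j (flux j) x
                   + \sum_(k < 2) gcon p i k * flux j x
                       * del j (fun y => covel (P y) k) x)
           + g * (gcon p i j * jac p * dep p)
               * (del j (fun y => dep (P y)) x + del j (fun y => bot (P y)) x)))
      + ec_source p (lift ord0 i) 0).

Lemma pd_pressure {R : realType} (A B h : 'rV[R]_2 -> R) (c : R) a x :
  differentiable A x -> differentiable B x -> differentiable h x ->
  pd a (fun y => A y + c * (h y * h y * B y)) x
  = pd a A x + c * (2 * h x * pd a h x * B x + h x ^+ 2 * pd a B x).
Proof.
move=> dA dB dh; have dhh : differentiable (fun y => h y * h y) x.
  exact: differentiableM.
have dhhB : differentiable (fun y => h y * h y * B y) x by exact: differentiableM.
rewrite pdD //; last exact: (@differentiableM _ _ (cst c)).
by rewrite (pdZ _ _ _ _ dhhB) (pdM _ _ _ _ dhh dB) (pdM _ _ _ _ dh dh); ring.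
Qed.

(** The pointwise algebra behind the momentum equation.  Here [A], [S], [dvi],
    [dh], [db] and [C j k] are the derivatives d_j of J h v^j v^i, J h v^j, v^i, h,
    b and v_k, while [KJ j] is J G^ij, [B j] its derivative d_j, and [vc] the
    covariant velocity.  The covariant third of the split yields one half of
    h v^j (Gamma^i_jk v^k + G^ik Gamma^l_jk v_l), and the geometric source one
    half of the difference of the same two terms. *)
Lemma momentum_balance {R : realType} (g J h co : R) (v vc : 'I_2 -> R)
    (Gi : 'M[R]_2) (Gam : 'I_2 -> 'I_2 -> 'I_2 -> R) (i : 'I_2)
    (A S dvi dh db B KJ : 'I_2 -> R) (C : 'I_2 -> 'I_2 -> R) :
  J != 0 ->
  (forall j, A j = S j * v i + J * h * v j * dvi j) ->
  (forall j, \sum_(k < 2) Gi i k * C j k =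
     \sum_(k < 2) (Gam i j k * v k + \sum_(l < 2) Gi i k * Gam l j k * vc l) + dvi j) ->
  (forall j, KJ j = J * Gi i j) ->
  \sum_(j < 2) B j = - (J * \sum_(j < 2) \sum_(k < 2) Gam i j k * Gi j k) ->
  - (J^-1 * \sum_(j < 2)
        (2^-1 * (A j + v i * S j + \sum_(k < 2) Gi i k * (J * h * v j) * C j k)
         + g * (Gi i j * J * h) * (dh j + db j)))
  + (- (2^-1 * (\sum_(j < 2) \sum_(k < 2) Gam i j k * h * v j * v k
               - \sum_(j < 2) \sum_(k < 2) \sum_(l < 2)
                   Gi i k * Gam l j k * h * v j * vc l)) - co)
  = - (J^-1 * \sum_(j < 2)
        (A j + g / 2 * (2 * h * dh j * KJ j + h ^+ 2 * B j))) - co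
    - \sum_(j < 2) g * h * Gi i j * db j
    - \sum_(j < 2) \sum_(k < 2) Gam i j k * (h * v j * v k + g / 2 * h ^+ 2 * Gi j k).
Proof.
move=> J0 hA hC hK hB.
have hC' j : \sum_(k < 2) Gi i k * (J * h * v j) * C j k =
    J * h * v j * (\sum_(k < 2) (Gam i j k * v k
      + \sum_(l < 2) Gi i k * Gam l j k * vc l) + dvi j).
  by rewrite -hC mulr_sumr; apply: eq_bigr => k _; ring.
under eq_bigr do rewrite hC' hA.
under [in RHS]eq_bigr do rewrite hK hA.
rewrite !sum2 in hB *; move/(canRL (addrK _)): hB => ->.
by field.
Qed.

(** The calculus consists in expanding the derivatives of products, of v_k = G_kl v^l
    and of the pressure h^2 (J G^ij); [metric_compatibility] and
    [divergence_metric] then provide the hypotheses of [momentum_balance]. *)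
Lemma split_rhs_pd {R : realType} (g : R) (X : 'rV[R]_2 -> 'rV[R]_3)
    (f h : 'rV[R]_2 -> R) (v : 'I_2 -> 'rV[R]_2 -> R) (b : 'rV[R]_2 -> R) x :
  element_map X -> smooth h -> (forall i, smooth (v i)) -> square x ->
  split_rhs g pd (field_state X f h v b) x = swe_rhs g (field_state X f h v b) x.
Proof.
move=> mapX smh smv sx; have smX : smooth X by case: mapX.
pose G := metric X; pose J y := Num.sqrt (\det (G y)).
have det_gt0 := det_metric_gt0 X x mapX sx.
have J0 : J x != 0 by rewrite gt_eqF // sqrtr_gt0.
have det0 : \det (G x) != 0 by rewrite gt_eqF.
have dG k l := differentiable_metric X x k l smX sx.
have dh := smooth_differentiable h x smh sx.
have dv i := smooth_differentiable (v i) x (smv i) sx.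
have dJ := differentiable_jacobian X x mapX sx.
have dflux j : differentiable (fun y => J y * h y * v j y) x.
  by apply: differentiableM => //; apply: differentiableM.
rewrite /split_rhs /swe_rhs /=; congr vec3; apply/funext => i.
have pd_covel j k : pd j (fun y => covel (field_state X f h v b y) k) x =
    \sum_(l < 2) dmetric X x j k l * v l x + \sum_(l < 2) G x k l * pd j (v l) x.
  have -> : (fun y => covel (field_state X f h v b y) k) =
      (fun y => metric X y k ord0 * v ord0 y + metric X y k ord_max * v ord_max y).
    by apply/funext => y; rewrite /covel sum2.
  rewrite pdD; try exact: differentiableM.
  rewrite (pdM _ _ _ _ (dG k ord0) (dv ord0)) (pdM _ _ _ _ (dG k ord_max) (dv ord_max)).
  by rewrite !sum2 !dmetricE addrACA.
have JGE j y : 0 < \det (G y) -> J y * invmx (G y) i j = adj2 (G y) i j / J y.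
  move=> dy; have Jy : J y != 0 by rewrite gt_eqF // sqrtr_gt0.
  rewrite invmx2 ?gt_eqF // -[\det (G y)]sqr_sqrtr ?ltW // -/(J y).
  by field.
(* The inverse metric has the quotient form only where det G is nonzero, which
   holds near x and suffices for the derivative at x. *)
have pd_mom j : pd j (fun y => J y * tau g (field_state X f h v b y) i j) x =
    pd j (fun y => J y * h y * v j y * v i y) x
    + g / 2 * (2 * h x * pd j h x * (adj2 (G x) i j / J x)
               + h x ^+ 2 * pd j (fun y => adj2 (G y) i j / J y) x).
  have dJV : differentiable (fun y => (J y)^-1) x by exact: differentiableV.
  have dK := differentiable_adj2_metric X x mapX sx i j.
  have dKJ : differentiable (fun y => adj2 (G y) i j / J y) x.
    exact: differentiableM.
  transitivity (pd j (fun y => J y * h y * v j y * v i y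
      + (g / 2) * ((h y * h y) * (adj2 (G y) i j / J y))) x).
    apply: near_eq_derive; near=> y.
    rewrite -JGE; last by near: y; exact: near_det_metric_gt0.
    by rewrite /tau /=; ring.
  apply: (pd_pressure (fun y => J y * h y * v j y * v i y)
    (fun y => adj2 (G y) i j / J y)) => //.
  exact: differentiableM.
have contr_covel j : \sum_(k < 2) invmx (G x) i k
      * pd j (fun y => covel (field_state X f h v b y) k) x
    = \sum_(k < 2) (christoffel X x i j k * v k x
        + \sum_(l < 2) invmx (G x) i k * christoffel X x l j k
            * covel (field_state X f h v b x) l) + pd j (v i) x.
  under eq_bigr do rewrite pd_covel mulrDr.
  rewrite big_split /=; congr (_ + _).
    rewrite (@metric_compatibility _ (G x) (dmetric X x) (v^~ x) i j det0).
    - apply: eq_bigr => k _; rewrite (christoffelE X x); congr (_ + _).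
      by apply: eq_bigr => l _; rewrite (christoffelE X x).
    - by move=> k l; exact: metricC.
    - by move=> a k l; rewrite !dmetricE; congr (pd a _ x);
        apply/funext => y; exact: metricC.
  exact: (invmx_contract (G x) (fun l => pd j (v l) x)).
have eq_pd : \sum_(j < 2) pd j (fun y => J y * tau g (field_state X f h v b y) i j) x
    = \sum_(j < 2) (pd j (fun y => J y * h y * v j y * v i y) x
      + g / 2 * (2 * h x * pd j h x * (adj2 (G x) i j / J x)
               + h x ^+ 2 * pd j (fun y => adj2 (G y) i j / J y) x)).
  by apply: eq_bigr => j _; exact: pd_mom.
rewrite vec3_lift eq_pd.
apply: (momentum_balance g (J x) (h x) _ (fun j => v j x) _
  (invmx (G x)) (christoffel X x) i) => //.
- by move=> j; exact: pdM (dflux j) (dv i).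
- exact: contr_covel.
- by move=> j; rewrite -JGE.
- exact: divergence_metric.
Unshelve. all: by end_near. Qed.

(** * The split form as a formal expression *)

Definition asum {R : realType} (F : 'I_2 -> aexpr R) : aexpr R :=
  AAdd (F ord0) (F ord_max).
Definition dsum {R : realType} (F : 'I_2 -> dexpr R) : dexpr R :=
  DAdd (F ord0) (F ord_max).
Definition aneg {R : realType} (e : aexpr R) : aexpr R := AMul (ACst (-1)) e.

Section SplitExpression.
Context {R : realType}.

Definition flux_expr (j : 'I_2) : aexpr R :=
  AMul (AMul AJac ADep) (AVel j).

Definition covel_expr (k : 'I_2) : aexpr R :=
  asum (fun l => AMul (AGcov k l) (AVel l)).

Definition source_expr (i : 'I_2) : aexpr R :=
  AAdd
    (aneg (AMul (ACst 2^-1) (AAdd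
      (asum (fun j => asum (fun k =>
         AMul (AMul (AMul (AGam i j k) ADep) (AVel j)) (AVel k))))
      (aneg (asum (fun j => asum (fun k => asum (fun l =>
         AMul (AMul (AMul (AMul (AGcon i k) (AGam l j k)) ADep) (AVel j))
           (covel_expr l)))))))))
    (aneg (asum (fun j => asum (fun k =>
      AMul (AMul (AMul (AMul (AMul ACor AJac) (AGcon i j)) (ACst (eps j k)))
        ADep) (AVel k))))).

Definition momentum_expr (g : R) (i : 'I_2) : dexpr R :=
  DAdd
    (DMul (DAlg (aneg (AInv AJac))) (dsum (fun j =>
      DAdd
        (DMul (DAlg (ACst 2^-1)) (DAdd (DAdd
          (DPartial j (AMul (flux_expr j) (AVel i)))
          (DMul (DAlg (AVel i)) (DPartial j (flux_expr j))))
          (dsum (fun k => DMul (DAlg (AMul (AGcon i k) (flux_expr j)))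
                            (DPartial j (covel_expr k))))))
        (DMul (DAlg (AMul (ACst g) (AMul (AMul (AGcon i j) AJac) ADep)))
          (DAdd (DPartial j ADep) (DPartial j ABot))))))
    (DAlg (source_expr i)).

Definition split_expr (g : R) (c : 'I_3) : dexpr R :=
  if unlift ord0 c is Some i then momentum_expr g i
  else DMul (DAlg (aneg (AInv AJac))) (dsum (fun j => DPartial j (flux_expr j))).

Lemma aeval_asum (F : 'I_2 -> aexpr R) p :
  aeval (asum F) p = \sum_(j < 2) aeval (F j) p.
Proof. by rewrite sum2. Qed.

(** For every interpretation of the derivative symbols, so that the nodal and the
    smooth evaluation are instances of one identity. *)
Lemma deval_split (g : R) (T : Type) (del : 'I_2 -> (T -> R) -> T -> R)
    (P : T -> state R) (x : T) :
  \col_c deval del P (split_expr g c) x = split_rhs g del P x.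
Proof.
have covelE k : (fun y => covel (P y) k) = (fun y => aeval (covel_expr k) (P y)).
  by apply/funext => y; rewrite aeval_asum.
have sourceE i p : ec_source p (lift ord0 i) 0 = aeval (source_expr i) p.
  by rewrite vec3_lift /= /covel !sum2; ring.
apply/matrixP => c d; rewrite ord1 mxE /split_expr /split_rhs.
case: (unliftP ord0 c) => [i|] ->.
  rewrite vec3_lift sourceE !sum2 !covelE /=; congr (_ + _).
  by rewrite mulrA mulN1r mulNr.
by rewrite vec3_ord0 !sum2 /= mulN1r mulNr.
Qed.

End SplitExpression.

(** * Flux differencing *)

Section FluxDifferencing.
Context {R : realType}.
Implicit Types (g : R) (p : state R).

Lemma ec_flux_diag g j p : \det (gcov p) != 0 -> ec_flux g j p p = Jflux g j p.
Proof.
move=> dG; apply/matrixP => c d; rewrite ord1 [RHS]mxE.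
case: (unliftP ord0 c) => [i|] ->.
  rewrite !vec3_lift /tau.
  have -> : \sum_(k < 2) gcon p i k * jac p * dep p * vel p j * covel p k
      = jac p * dep p * vel p j * vel p i.
    have <- : \sum_(k < 2) gcon p i k * covel p k = vel p i.
      exact: invmx_contract.
    by rewrite mulr_sumr; apply: eq_bigr => k _; ring.
  by field.
by rewrite !mxE !unlift_none; field.
Qed.

(** A flux difference with weights of zero sum differentiates the right state
    only.  With the weights 2 w_m, the factor 1/4 of the advective split becomes
    1/2 and the factor g/2 of the pressure becomes g. *)
Lemma ec_flux_difference g a p (I : finType) (w : I -> R) (q : I -> state R) :
  \sum_m w m = 0 ->
  \sum_m (2 * w m) *: ec_flux g a p (q m) =
  vec3 (\sum_m w m * (jac (q m) * dep (q m) * vel (q m) a))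
    (fun i => 2^-1 * (\sum_m w m * (jac (q m) * dep (q m) * vel (q m) a * vel (q m) i)
                 + vel p i * (\sum_m w m * (jac (q m) * dep (q m) * vel (q m) a))
                 + \sum_(k < 2) gcon p i k * (jac p * dep p * vel p a)
                     * (\sum_m w m * covel (q m) k))
       + g * (gcon p i a * jac p * dep p)
           * (\sum_m w m * dep (q m) + \sum_m w m * bot (q m))).
Proof.
move=> w0.
(* [K] collects the part of the flux that depends on the left state alone. *)
have add_const (K y z : R) : z = y + K * (\sum_m w m) -> z = y.
  by rewrite w0 mulr0 addr0.
apply/matrixP => c d; rewrite ord1 summxE.
under eq_bigr do rewrite mxE.
case: (unliftP ord0 c) => [i|] ->.
  under eq_bigr do rewrite vec3_lift.
  rewrite vec3_lift /=; apply: (add_const (2^-1 * (jac p * dep p * vel p a * vel p i)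
    - g * (gcon p i a * jac p * dep p) * bot p)).
  rewrite !sum2 !mulrDr !mulr_sumr -!big_split /=; apply: eq_bigr => m _.
  by rewrite ?sum2; field.
under eq_bigr do rewrite mxE unlift_none.
rewrite mxE unlift_none; apply: (add_const (jac p * dep p * vel p a)).
by rewrite mulr_sumr -big_split /=; apply: eq_bigr => m _; field.
Qed.

Context (g : R) {S : set 'rV[R]_3} (M : mesh S) {N : nat}.
Context (xi omega : 'I_N.+1 -> R) (f : elt M -> 'rV[R]_2 -> R).
Context (b : elt M -> node N -> R) (u : nodal M (N := N)).
Context (lgl : LGL xi omega).
Local Notation P := (node_state xi f b u).

Lemma node_pt_square (n : node N) : square (node_pt xi n).
Proof.
by move=> a; rewrite mxE; case: ifP => _; exact: LGL_node_square lgl.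
Qed.

Lemma det_node_metric_gt0 (k : elt M) (n : node N) :
  0 < \det (metric (chart k) (node_pt xi n)).
Proof. by apply: det_metric_gt0; [exact: mesh_chart | exact: node_pt_square]. Qed.

Lemma strong_volume_split (k : elt M) (n : node N) :
  strong_volume (ec_flux g) ec_source xi f b u k n = split_rhs g (sbp xi) (P k) n.
Proof.
have entryE (z : R) (A B C : 'cV[R]_3) c :
    (- (z *: A) - z *: B + C) c 0 = - (z * A c 0) - z * B c 0 + C c 0.
  by rewrite !mxE.
case: n => i j; rewrite /strong_volume; cbv beta match zeta.
move: (P k) => Q.
have D0 l : \sum_(m < N.+1) Dmat xi l m = 0 by exact: Dmat_sum lgl.
rewrite (ec_flux_difference g ord0 _ _ (Dmat xi i) (fun m => Q (m, j)) (D0 i)).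
rewrite (ec_flux_difference g ord_max _ _ (Dmat xi j) (fun m => Q (i, m)) (D0 j)).
apply/matrixP => c d; rewrite ord1 entryE /split_rhs.
have dirE (z A B C : R) : - (z * A) - z * B + C = - (z * (A + B)) + C by ring.
case: (unliftP ord0 c) => [l|] ->.
  by rewrite [RHS]vec3_lift 2!vec3_lift dirE [in RHS](sum2 (fun j0 => _ + _)).
by rewrite [RHS]vec3_ord0 2!vec3_ord0 dirE [in RHS]sum2
  [ec_source _ _ _]vec3_ord0 addr0.
Qed.

(** S = 2 M D - B row by row: the boundary matrix only sees the node itself, where
    the two-point flux reduces to the flux. *)
Lemma Smat_sum (F : 'I_N.+1 -> 'cV[R]_3) i :
  \sum_m Smat xi omega i m *: F m =
  omega i *: (\sum_m (2 * Dmat xi i m) *: F m)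
  - ((i == ord_max)%:R - (i == ord0)%:R) *: F i.
Proof.
have SE m : Smat xi omega i m = omega i * (2 * Dmat xi i m)
    - (i == m)%:R * ((i == ord_max)%:R - (i == ord0)%:R).
  rewrite /Smat /Qmat /Mmat mul_diag_mx !mxE.
  by case: eqVneq => [->|_]; rewrite ?mulr1n ?mulr0n /=; ring.
under eq_bigr do rewrite SE scalerBl -[X in X - _]scalerA -[X in _ - X]scalerA.
rewrite sumrB -scaler_sumr; congr (_ - _).
rewrite (bigD1 i) //= eqxx scale1r big1 ?addr0 // => m; rewrite eq_sym => /negbTE ->.
by rewrite scale0r.
Qed.

Lemma flux_diff_strong (k : elt M) (n : node N) :
  flux_diff_rhs (ec_flux g) (ec_flux g) ec_source xi omega f b u k n =
  (omega n.1 * omega n.2 * jac (P k n)) *: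
    (strong_volume (ec_flux g) ec_source xi f b u k n
     + strong_interface g (ec_flux g) xi omega f b u k n).
Proof.
case: n => i j.
have dG := det_node_metric_gt0 k (i, j).
have J0 : jac (P k (i, j)) != 0 by rewrite gt_eqF // sqrtr_gt0.
have w0 l : omega l != 0 by rewrite gt_eqF //; case: lgl.
(* The indicator of l = q allows the interior flux at the face node q to be
   evaluated at l. *)
have bracketE (l q : 'I_N.+1) (z y : R) (I : 'cV[R]_3) (F : 'I_N.+1 -> 'cV[R]_3) :
    ((l == q)%:R / z) *: (y *: (I - F q)) = ((l == q)%:R / z) *: (y *: (I - F l)).
  by case: eqVneq => [->//|_]; rewrite !mul0r !scale0r.
rewrite /flux_diff_rhs /strong_volume /strong_interface; cbv beta match zeta.
have diag a := ec_flux_diag g a (P k (i, j)) (lt0r_neq0 dG).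
rewrite /bracket /side_node /=.
move: (int_flux _ _ _ _ _ _ (ord0, false) j) (int_flux _ _ _ _ _ _ (ord0, true) j).
move: (int_flux _ _ _ _ _ _ (ord_max, false) i)
  (int_flux _ _ _ _ _ _ (ord_max, true) i).
move: (P k) J0 diag => Q J0 diag I1 I2 I3 I4.
rewrite (Smat_sum (fun m => ec_flux g ord0 (Q (i, j)) (Q (m, j)))).
rewrite (Smat_sum (fun m => ec_flux g ord_max (Q (i, j)) (Q (i, m)))).
rewrite (diag ord0) (diag ord_max).
rewrite (bracketE i ord0 _ _ _ (fun q => Jflux g ord0 (Q (q, j)))).
rewrite (bracketE i ord_max _ _ _ (fun q => Jflux g ord0 (Q (q, j)))).
rewrite (bracketE j ord0 _ _ _ (fun q => Jflux g ord_max (Q (i, q)))).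
rewrite (bracketE j ord_max _ _ _ (fun q => Jflux g ord_max (Q (i, q)))).
move: (\sum_m _) (\sum_m _) => V1 V2.
move: (jac _) (ec_source _) (Jflux _ ord0 _) (Jflux _ ord_max _) J0 => J s F1 F2 J0.
apply/matrixP => c d; rewrite !mxE.
by field; rewrite J0 !w0.
Qed.

Lemma local_compZ (k : elt M) (n : node N) (c : R) w i :
  local_comp xi k n (c *: w) i = c * local_comp xi k n w i.
Proof.
rewrite /local_comp mulr_sumr; apply: eq_bigr => j _.
by rewrite /dotv linearZ /= -scalemxAr [X in _ * X]mxE mulrCA.
Qed.

Lemma local_comp_tangent (k : elt M) (n : node N) v i :
  local_comp xi k n (tangent_vec xi k n v) i = v i.
Proof.
have dotE j : dotv (pd j (chart k) (node_pt xi n)) (tangent_vec xi k n v)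
    = \sum_(l < 2) metric (chart k) (node_pt xi n) j l * v l.
  rewrite /dotv /tangent_vec linear_sum /= mulmx_sumr summxE.
  apply: eq_bigr => l _; rewrite linearZ /= -scalemxAr [LHS]mxE mulrC.
  by congr (_ * _); rewrite [RHS]mxE.
rewrite /local_comp; under eq_bigr do rewrite dotE.
by apply: invmx_contract; rewrite gt_eqF // det_node_metric_gt0.
Qed.

(** Equal velocity vectors in space have equal components in the local basis of the
    interior node, and all the geometric data of the external state are those of
    the interior node by definition. *)
Lemma ext_state_continuous (k : elt M) (s : side) (m : 'I_N.+1) :
  (forall k n, 0 < u_dep (u k n)) -> continuous_across xi f b u ->
  ext_state xi f b u k s m = P k (side_node s m).
Proof.
move=> dep_gt0 /(_ k s m) /=; set n := side_node s m; set k' := ext_elt k s.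
set n' := ext_node k s m => -[hE vE bE].
have {}hE : u_dep (u k' n') = u_dep (u k n) := esym hE.
have h0 : u_dep (u k n) != 0 by rewrite gt_eqF.
rewrite /ext_state -/n -/k' -/n' /node_state -bE hE.
congr geo_state; apply/funext => i.
have -> : tangent_vec xi k' n' (u_mom (u k' n')) =
    u_dep (u k n) *: tangent_vec xi k n (vel (P k n)).
  rewrite vE -hE /tangent_vec scaler_sumr; apply: eq_bigr => l _.
  by rewrite hE scalerA mulrCA (mulfV h0) mulr1.
by rewrite local_compZ local_comp_tangent [LHS]mulrC (mulKf h0).
Qed.

End FluxDifferencing.

Theorem lemma3 (R : realType) (g : R) (hg : 0 < g) :
  consistent_discretization g (ec_flux g) (ec_flux g) ec_source.
Proof.
exists (split_expr g); split.
  move=> X f h v b mapX smh smv smb _ x sx.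
  by rewrite deval_split; exact: split_rhs_pd.
move=> S M N xi omega f b u t lgl dep_gt0; split.
- have rhsE k n := flux_diff_strong g M xi omega f b (u t) lgl k n.
  have nz k (n : node N) : omega n.1 * omega n.2 *
      jac (node_state xi f b (u t) k n) != 0.
    rewrite !mulf_neq0 // gt_eqF //; try by case: lgl.
    by rewrite sqrtr_gt0 (det_node_metric_gt0 _ _ omega).
  split=> sol k n; have [du eqn] := sol k n; split=> //.
    by apply: (scalerI (nz k n)); rewrite eqn rhsE.
  by rewrite eqn rhsE.
- move=> cont k s m.
  rewrite /bracket /int_flux (ext_state_continuous M xi omega) //.
  rewrite ec_flux_diag ?subrr // gt_eqF //.
  exact: det_node_metric_gt0 lgl _ _.
- move=> k n; rewrite deval_split.
  exact: (strong_volume_split g M xi omega f b (u t) lgl k n).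
Qed.
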